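(* Let $A$ be a minimal finite algebra over a field $\mathbf F$. Then every countable algebra of the variety $\operatorname{var}A$ can be isomorphically embedded in the free algebra of countable rank of the variety $\operatorname{var}A$.
   Context: An algebra over a field $\mathbf F$ is a vector space over $\mathbf F$ with a bilinear multiplication (not assumed associative, commutative or unital). A nonzero algebra is minimal if it has no proper nonzero subalgebras. $\operatorname{var}A$ is the class of all $\mathbf F$-algebras satisfying every identity $v(x_1,\dots,x_n)=0$ that holds in $A$, where $v$ ranges over nonassociative polynomials over $\mathbf F$ without constant term. The free algebra of countable rank in a variety $\mathfrak V$ is the algebra of $\mathfrak V$ generated by a countably infinite set $X$ such that every map from $X$ to an algebra $P\in\mathfrak V$ extends to a homomorphism to $P$. *)

(* Defs.v *)
From HB Require Import structures.
From mathcomp Require Import all_boot all_order all_algebra.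
From mathcomp Require Import finmap monalg.
From mathcomp Require Import boolp classical_sets functions cardinality.

Set Implicit Arguments.
Unset Strict Implicit.
Unset Printing Implicit Defensive.

Import GRing.Theory.

Local Open Scope ring_scope.
Local Open Scope classical_set_scope.

HB.mixin Record Lmodule_isNAAlgebra (F : fieldType) A of GRing.Lmodule F A := {
  namul : A -> A -> A;
  namul_is_bilinear : bilinear_for *:%R *:%R namul
}.

#[short(type="naAlgType")]
HB.structure Definition NAAlgebra (F : fieldType) :=
  {A of GRing.Lmodule F A & Lmodule_isNAAlgebra F A}.

HB.instance Definition _ (F : fieldType) (A : naAlgType F) :=
  bilinear_isBilinear.Build F A A A *:%R *:%R (@namul F A)
    (@namul_is_bilinear F A).

Declare Scope naalg_scope.
Delimit Scope naalg_scope with NA.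
Notation "x ** y" := (namul x y)
  (at level 40, left associativity) : naalg_scope.
Local Open Scope naalg_scope.

(* Nonassociative words. There is no empty word, so linear combinations of
   words have no constant term. *)
Inductive naword : Type :=
| NAVar of nat
| NAMul of naword & naword.

Fixpoint naword_encode (w : naword) : GenTree.tree nat :=
  match w with
  | NAVar i => GenTree.Leaf i
  | NAMul w1 w2 => GenTree.Node 0 [:: naword_encode w1; naword_encode w2]
  end.

Fixpoint naword_decode (t : GenTree.tree nat) : option naword :=
  match t with
  | GenTree.Leaf i => Some (NAVar i)
  | GenTree.Node _ [:: t1; t2] =>
      if (naword_decode t1, naword_decode t2) is (Some w1, Some w2)
      then Some (NAMul w1 w2) else None
  | _ => None
  end.

Lemma naword_encodeK : pcancel naword_encode naword_decode.
Proof. by elim=> [i|w1 IH1 w2 IH2] //=; rewrite IH1 IH2. Qed.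

HB.instance Definition _ := Countable.copy naword (pcan_type naword_encodeK).

Definition napoly (F : fieldType) : Type := {malg F[naword]}.

Section Algebras.
Variable F : fieldType.
Implicit Types A P : naAlgType F.

Fixpoint naword_eval A (x : nat -> A) (w : naword) : A :=
  match w with
  | NAVar i => x i
  | NAMul w1 w2 => naword_eval x w1 ** naword_eval x w2
  end.

Definition napoly_eval A (x : nat -> A) (v : napoly F) : A :=
  \sum_(w <- msupp v) v@_w *: naword_eval x w.

Definition na_identity A (v : napoly F) : Prop :=
  forall x : nat -> A, napoly_eval x v = 0.

Definition in_var A P : Prop :=
  forall v : napoly F, na_identity A v -> na_identity P v.

Definition is_subalgebra A (S : set A) : Prop :=
  [/\ S 0,
      forall (a : F) (x y : A), S x -> S y -> S (a *: x + y)
    & forall x y : A, S x -> S y -> S (x ** y)].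

Definition minimal_algebra A : Prop :=
  (exists x : A, x <> 0) /\
  (forall S : set A, is_subalgebra S -> S <> [set 0] -> S = [set: A]).

Definition is_hom A P (f : {linear A -> P}) : Prop :=
  forall x y : A, f (x ** y) = f x ** f y.

(* Fr is the free algebra of countable rank of the variety V, with set of free
   generators X. A map X -> P is given as the restriction to X of a map
   Fr -> P, which loses nothing since P is inhabited. *)
Definition free_countable_rank (V : naAlgType F -> Prop)
    (Fr : naAlgType F) (X : set Fr) : Prop :=
  [/\ V Fr,
      countable X /\ infinite_set X,
      smallest (@is_subalgebra Fr) X = [set: Fr]
    & forall P, V P -> forall g : Fr -> P,
        exists2 f : {linear Fr -> P}, is_hom f & {in X, f =1 g}].

Definition embeds A P : Prop :=
  exists2 f : {linear A -> P}, is_hom f & injective f.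

End Algebras.

(* Main.v *)
(* Let (b_n) enumerate B.  It is enough to find polynomials t_n with t_n(b) = b_n
   such that, for every assignment x in A, the t_n(x) satisfy all the relations
   of the b_n: then b_n |-> t_n(x) also defines a homomorphism from B to Fr, with
   x now distinct free generators, and it is a section of the homomorphism
   Fr -> B extending x_n |-> b_n.  Take t_n = r_n(t_0, ..., t_{n-1}, x_n), where
   r_n(c, a) corrects the last entry of (c, a) so that the relations between
   b_0, ..., b_n hold as soon as c satisfies those between b_0, ..., b_{n-1}.
   If A has zero multiplication, r_n comes from linear algebra.  Otherwise the
   minimality and the finiteness of A give a binary polynomial q with
   q(0, y) = 0 and q(x, y) = y for x nonzero, hence definitions by cases: the
   relations between b_0, ..., b_n amount to a single one, v = 0, and r_n
   searches a finite list of polynomials in c for a root of v(c, _). *)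

Require Import Defs.
From HB Require Import structures.
From mathcomp Require Import all_boot all_order all_algebra.
From mathcomp Require Import finmap monalg.
From mathcomp Require Import boolp classical_sets functions cardinality.

Set Implicit Arguments.
Unset Strict Implicit.
Unset Printing Implicit Defensive.

Import GRing.Theory.

Local Open Scope ring_scope.
Local Open Scope classical_set_scope.
Local Open Scope naalg_scope.

(* Syntactic polynomials, on which substitution is structural, unlike on
   [napoly]. *)
Inductive term (F : Type) : Type :=
| TZero
| TVar of nat
| TAdd of term F & term F
| TScale of F & term F
| TMul of term F & term F.
Arguments TZero {F}.
Arguments TVar {F}.

Fixpoint teval (F : fieldType) (P : naAlgType F) (x : nat -> P) (t : term F) : P :=
  match t with
  | TZero => 0
  | TVar i => x i
  | TAdd t1 t2 => teval x t1 + teval x t2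
  | TScale a t1 => a *: teval x t1
  | TMul t1 t2 => teval x t1 ** teval x t2
  end.

Fixpoint tsubst (F : Type) (s : nat -> term F) (t : term F) : term F :=
  match t with
  | TZero => TZero
  | TVar i => s i
  | TAdd t1 t2 => TAdd (tsubst s t1) (tsubst s t2)
  | TScale a t1 => TScale a (tsubst s t1)
  | TMul t1 t2 => TMul (tsubst s t1) (tsubst s t2)
  end.

Definition TSub (F : fieldType) (t u : term F) : term F := TAdd t (TScale (-1) u).

(** Sending the later variables to zero matches the default value in [nth 0]. *)
Definition ttrunc (F : Type) (n : nat) : term F -> term F :=
  tsubst (fun i => if i < n then TVar i else TZero)%N.

(** * Evaluation, substitution and transfer of identities *)

Section Evaluation.
Variables (F : fieldType).
Implicit Types (P : naAlgType F) (t : term F) (v : napoly F).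

Lemma eq_teval P (x y : nat -> P) t : x =1 y -> teval x t = teval y t.
Proof. by move=> e; elim: t => //= [t1 -> t2 ->|a t1 ->|t1 -> t2 ->]. Qed.

Lemma teval_subst P (x : nat -> P) s t :
  teval x (tsubst s t) = teval (fun i => teval x (s i)) t.
Proof. by elim: t => //= [t1 -> t2 ->|a t1 ->|t1 -> t2 ->]. Qed.

Lemma teval0 P (x : nat -> P) t : (forall i, x i = 0) -> teval x t = 0.
Proof.
move=> x0; elim: t => //= [t1 -> t2 ->|a t1 ->|t1 -> t2 ->].
- by rewrite addr0.
- by rewrite scaler0.
- by rewrite linear0l.
Qed.

Lemma teval_sub P (x : nat -> P) t u : teval x (TSub t u) = teval x t - teval x u.
Proof. by rewrite /TSub /= scaleN1r. Qed.

Lemma teval_trunc P (x : nat -> P) n t :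
  teval x (ttrunc n t) = teval (nth 0 (mkseq x n)) t.
Proof.
rewrite teval_subst; apply: eq_teval => i.
case: ltnP => [lt_in|le_ni]; first by rewrite nth_mkseq.
by rewrite nth_default // size_mkseq.
Qed.

Lemma teval_finite_support t : exists n, forall P (x : nat -> P),
  teval x t = teval x (ttrunc n t).
Proof.
(* All larger bounds are allowed too, so that two subterms can share one. *)
suff [n nP] : exists n, forall m, (n <= m)%N ->
    forall P (x : nat -> P), teval x t = teval x (ttrunc m t).
  by exists n => P x; apply: nP.
elim: t => [|i|t1 [n1 e1] t2 [n2 e2]|a t1 [n1 e1]|t1 [n1 e1] t2 [n2 e2]].
- by exists 0%N.
- by exists i.+1 => m lt_im P x; rewrite /ttrunc /= lt_im.
- exists (maxn n1 n2) => m; rewrite geq_max => /andP[le1 le2] P x /=.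
  by rewrite (e1 m) // (e2 m).
- by exists n1 => m le1 P x /=; rewrite (e1 m).
- exists (maxn n1 n2) => m; rewrite geq_max => /andP[le1 le2] P x /=.
  by rewrite (e1 m) // (e2 m).
Qed.

Lemma mkseq_rcons (T : Type) (x : nat -> T) n :
  mkseq x n.+1 = rcons (mkseq x n) (x n).
Proof. by rewrite /mkseq -addn1 iotaD map_cat cats1. Qed.

Lemma napoly_evalEw P (x : nat -> P) (d : {fset naword}) (v : {malg F[naword]}) :
  (msupp v `<=` d)%fset ->
  napoly_eval x v = \sum_(w <- d) v@_w *: naword_eval x w.
Proof.
move=> le_vd; rewrite /napoly_eval (big_fset_incl _ le_vd) //= => w _ w_v.
by rewrite mcoeff_outdom ?scale0r.
Qed.

Lemma napoly_evalD P (x : nat -> P) (u v : {malg F[naword]}) :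
  napoly_eval x (u + v : {malg F[naword]}) = napoly_eval x u + napoly_eval x v.
Proof.
rewrite (napoly_evalEw x (msuppD_le u v)).
rewrite (napoly_evalEw x (fsubsetUl (msupp u) (msupp v))).
rewrite (napoly_evalEw x (fsubsetUr (msupp u) (msupp v))).
by rewrite -big_split; apply: eq_bigr => w _; rewrite mcoeffD scalerDl.
Qed.

Lemma napoly_eval0 P (x : nat -> P) : napoly_eval x (0 : {malg F[naword]}) = 0.
Proof. by rewrite /napoly_eval msupp0 big_seq_fset0. Qed.

Lemma napoly_evalZ P (x : nat -> P) a (v : {malg F[naword]}) :
  napoly_eval x (a *: v : {malg F[naword]}) = a *: napoly_eval x v.
Proof.
rewrite (napoly_evalEw x (msuppZ_le a v)) scaler_sumr.
by apply: eq_bigr => w _; rewrite mcoeffZ scalerA.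
Qed.

Lemma napoly_evalU P (x : nat -> P) a w :
  napoly_eval x (<< a *g w >> : {malg F[naword]}) = a *: naword_eval x w.
Proof. by rewrite (napoly_evalEw x msuppU_le) big_seq_fset1 mcoeffUU. Qed.

Lemma napoly_eval_sum P (x : nat -> P) I (r : seq I) (f : I -> {malg F[naword]}) :
  napoly_eval x (\sum_(i <- r) f i : {malg F[naword]}) =
  \sum_(i <- r) napoly_eval x (f i).
Proof. exact: (big_morph _ (napoly_evalD x) (napoly_eval0 x)). Qed.

(** Needed because [in_var] speaks of [napoly]; products are expanded by bilinearity. *)
Lemma term_napoly t : exists v : napoly F,
  forall P (x : nat -> P), napoly_eval x v = teval x t.
Proof.
elim: t => [|i|t1 [v1 e1] t2 [v2 e2]|a t1 [v1 e1]|t1 [v1 e1] t2 [v2 e2]].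
- by exists (0 : {malg F[naword]}) => P x; rewrite napoly_eval0.
- exists (<< 1 *g NAVar i >> : {malg F[naword]}) => P x.
  by rewrite napoly_evalU scale1r.
- exists ((v1 : {malg F[naword]}) + (v2 : {malg F[naword]})) => P x.
  by rewrite napoly_evalD e1 e2.
- exists (a *: (v1 : {malg F[naword]})) => P x.
  by rewrite napoly_evalZ e1.
- exists (\sum_(i <- msupp v1) \sum_(j <- msupp v2)
    << v1@_i * v2@_j *g NAMul i j >> : {malg F[naword]}) => P x /=.
  rewrite -e1 -e2 {2}/napoly_eval linear_sumlz napoly_eval_sum.
  apply: eq_bigr => i _; rewrite {2}/napoly_eval linear_sumr napoly_eval_sum.
  apply: eq_bigr => j _.
  by rewrite napoly_evalU linearZl_LR linearZr_LR /= scalerA.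
Qed.

Lemma identity_transfer (A P : naAlgType F) t :
  in_var A P -> (forall x : nat -> A, teval x t = 0) ->
  forall x : nat -> P, teval x t = 0.
Proof.
move=> AP idt x; have [v ev] := term_napoly t.
by rewrite -ev; apply: AP => y; rewrite ev.
Qed.

Lemma teval_hom (P Q : naAlgType F) (f : {linear P -> Q}) (x : nat -> P) t :
  is_hom f -> f (teval x t) = teval (f \o x) t.
Proof.
move=> fM; elim: t => //= [|t1 e1 t2 e2|a t1 e1|t1 e1 t2 e2].
- exact: linear0.
- by rewrite linearD e1 e2.
- by rewrite linearZ /= e1.
- by rewrite fM e1 e2.
Qed.

End Evaluation.

(** * Binary terms and definition by cases *)

Section BinaryTerms.
Variables (F : fieldType).

Definition TApp2 (q t u : term F) : term F := tsubst (nth TZero [:: t; u]) q.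

(** In A, for the q of [support_term], this is u where t vanishes and w elsewhere. *)
Definition TIte (q t u w : term F) : term F :=
  TAdd (TSub u (TApp2 q t u)) (TApp2 q t w).

Definition teval2 (P : naAlgType F) (q : term F) (x y : P) : P :=
  teval (nth 0 [:: x; y]) q.

Lemma teval_app2 (P : naAlgType F) (x : nat -> P) (q t u : term F) :
  teval x (TApp2 q t u) = teval2 q (teval x t) (teval x u).
Proof. by rewrite teval_subst; apply: eq_teval => -[|[|[]]]. Qed.

Lemma tevalE_ite (P : naAlgType F) (x : nat -> P) (q t u w : term F) :
  teval x (TIte q t u w) = teval x u - teval2 q (teval x t) (teval x u) +
    teval2 q (teval x t) (teval x w).
Proof. by rewrite -!teval_app2 -teval_sub. Qed.

End BinaryTerms.

(** * Interpolation on A and the binary polynomial q *)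

Section SupportTerm.
Variables (F : fieldType) (A : naAlgType F).
Hypotheses (A_minimal : minimal_algebra A) (A_finite : finite_set [set: A]).

(** The values of all terms at [a] form a subalgebra containing [a], so minimality applies. *)
Lemma generated_by_nonzero (a y : A) : a <> 0 ->
  exists s : term F, teval (fun=> a) s = y.
Proof.
move=> a0; pose S := [set teval (fun=> a) s | s in [set: term F]].
have subS : is_subalgebra S.
  split=> [|k _ _ [s _ <-] [t _ <-]|_ _ [s _ <-] [t _ <-]].
  - by exists TZero.
  - by exists (TAdd (TScale k s) t).
  - by exists (TMul s t).
have Sa : S a by exists (TVar 0).
have ST : S = [set: A].
  by apply: A_minimal.2 => // S0; apply: a0; rewrite S0 in Sa.
by have : [set: A] y by []; rewrite -ST => -[s _ sy]; exists s.
Qed.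

Hypothesis A_mul : exists u w : A, u ** w <> 0.

Definition zero_on_axes (m : term F) : Prop :=
  (forall y : A, teval2 m 0 y = 0) /\ (forall x : A, teval2 m x 0 = 0).

(* The values at (a, z) of the terms vanishing on the axes form a subalgebra,
   which contains the product of any two elements. *)
Lemma zero_on_axes_interpolation (a z y : A) : a <> 0 -> z <> 0 ->
  exists2 m, zero_on_axes m & teval2 m a z = y.
Proof.
move=> a0 z0; pose S := [set teval2 m a z | m in zero_on_axes].
have subS : is_subalgebra S.
  split=> [|k _ _ [s [sl sr] <-] [t [tl tr] <-]|_ _ [s [sl sr] <-] [t [tl tr] <-]].
  - by exists TZero.
  - exists (TAdd (TScale k s) t) => //; split=> u; rewrite /teval2 /=.
      by rewrite [X in _ *: X]sl [X in _ + X]tl scaler0 addr0.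
    by rewrite [X in _ *: X]sr [X in _ + X]tr scaler0 addr0.
  - exists (TMul s t) => //; split=> u; rewrite /teval2 /=.
      by rewrite [X in X ** _]sl linear0l.
    by rewrite [X in X ** _]sr linear0l.
have [u [w uw0]] := A_mul.
have [[s su] [t tw]] := (generated_by_nonzero u a0, generated_by_nonzero w z0).
have Suw : S (u ** w).
  (* The product s(x) t(y) vanishes on the axes because terms have no constant part. *)
  exists (TMul (tsubst (fun=> TVar 0) s) (tsubst (fun=> TVar 1) t)).
    by split=> x; rewrite /teval2 /= !teval_subst /= (@teval0 _ _ (fun=> 0)) //;
      rewrite ?linear0l ?linear0r.
  by rewrite /teval2 /= !teval_subst /= su tw.
have ST : S = [set: A].
  by apply: A_minimal.2 => // S0; apply: uw0; rewrite S0 in Suw.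
by have : [set: A] y by []; rewrite -ST => -[m m0 my]; exists m.
Qed.

(* With m(a, g(a, z)) = g(a, z), replacing g by g - m(x, g) makes g vanish at
   (a, z) while keeping its earlier zeros; finally q = y - g. *)
Lemma support_term :
  exists q : term F, forall x y : A, teval2 q x y = if x == 0 then 0 else y.
Proof.
have [eA eAE] := (finite_seqP [set: A]).1 A_finite.
have eAP x : x \in eA by have : [set: A] x by []; rewrite eAE.
suff [g [g0y gx0 gL]] : exists g : term F,
    [/\ forall y : A, teval2 g 0 y = y, forall x : A, teval2 g x 0 = 0
      & forall p : A * A, p \in [seq (a, z) | a <- eA, z <- eA] -> p.1 <> 0 ->
        teval2 g p.1 p.2 = 0].
  exists (TSub (TVar 1) g) => x y; rewrite /teval2 teval_sub /=.
  case: eqP => [->|x0]; first by rewrite [X in _ - X]g0y subrr.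
  by rewrite [X in _ - X](gL (x, y)) ?subr0 ?allpairs_f.
elim: [seq _ | _ <- _, _ <- _] => [|[a z] L [g [g0y gx0 gL]]].
  by exists (TVar 1).
have [[a0|gaz0]|] := pselect (a = 0 \/ teval2 g a z = 0).
- exists g; split=> // p; rewrite inE => /orP[/eqP->|]; first by [].
  exact: gL.
- exists g; split=> // p; rewrite inE => /orP[/eqP->|]; first by [].
  exact: gL.
move=> /not_orP[a0 gaz0].
have [m [ml mr] maz] := zero_on_axes_interpolation (teval2 g a z) a0 gaz0.
have g'E x y : teval2 (TSub g (TApp2 m (TVar 0) g)) x y =
    teval2 g x y - teval2 m x (teval2 g x y).
  by rewrite {1}/teval2 teval_sub teval_app2.
exists (TSub g (TApp2 m (TVar 0) g)); split=> [y|x|p].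
- by rewrite g'E g0y ml subr0.
- by rewrite g'E gx0 mr subr0.
- rewrite inE g'E => /orP[/eqP->|pL] p0; first by rewrite /= maz subrr.
  by rewrite gL // mr subr0.
Qed.

End SupportTerm.

(** * Compatible sequences and their extension by one entry *)

Section Compatibility.
Variables (F : fieldType) (A B : naAlgType F) (b : nat -> B).

(* The compatible sequences of size n are the images of (b_0, ..., b_{n-1})
   under the homomorphisms to A from the subalgebra these generate. *)
Definition compatible (c : seq A) : Prop :=
  forall t : term F, teval (nth 0 (mkseq b (size c))) t = 0 ->
    teval (nth 0 c) t = 0.

(** The correcting term r_n. Its first condition later yields t_n(b) = b_n. *)
Definition has_retraction (n : nat) : Prop := exists r : term F,
  teval (nth 0 (mkseq b n.+1)) r = b n /\
  forall (c : seq A) (a : A), size c = n -> compatible c ->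
    compatible (rcons c (teval (nth 0 (rcons c a)) r)).

End Compatibility.

(** * Zero multiplication: linear algebra *)

Section ZeroMultiplication.
Variables (F : fieldType) (A B : naAlgType F).
Hypotheses (A_mul0 : forall u w : A, u ** w = 0) (B_var : in_var A B).

Lemma var_mul0 (u w : B) : u ** w = 0.
Proof.
apply: (identity_transfer (t := TMul (TVar 0) (TVar 1)) B_var _
  (nth 0 [:: u; w])) => x.
exact: A_mul0.
Qed.

(** Here k is the coefficient of variable n in the linear part of t. It is chosen before P, hence
    shared by A and B. *)
Lemma teval_rcons_mul0 (t : term F) (n : nat) : exists k : F,
  forall P : naAlgType F, (forall u w : P, u ** w = 0) ->
  forall (c : seq P) (a : P), size c = n ->
    teval (nth 0 (rcons c a)) t = teval (nth 0 c) t + k *: a.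
Proof.
elim: t => [|i|t1 [k1 e1] t2 [k2 e2]|l t1 [k1 e1]|t1 _ t2 _].
- by exists 0 => P _ c a _; rewrite scale0r addr0.
- exists (i == n)%:R => P _ c a sc /=; rewrite nth_rcons sc.
  case: ltngtP => [lt_in|lt_ni|->]; rewrite ?scale0r ?addr0 //.
    by rewrite nth_default // sc ltnW.
  by rewrite nth_default ?sc // scale1r add0r.
- exists (k1 + k2) => P m0 c a sc /=.
  by rewrite (e1 P) // (e2 P) // scalerDl addrACA.
- exists (l * k1) => P m0 c a sc /=.
  by rewrite (e1 P) // scalerDr scalerA.
- by exists 0 => P m0 c a sc /=; rewrite !m0 scale0r addr0.
Qed.

Lemma has_retraction_mul0 (b : nat -> B) n : has_retraction A b n.
Proof.
have bS := mkseq_rcons b n.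
(* If b_n is the value of a term at the earlier entries, that term serves as r_n; otherwise any last
   entry will do. *)
have [[r rb]|nor] := pselect (exists r, teval (nth 0 (mkseq b n)) r = b n).
  have cS (P : naAlgType F) (c : seq P) y : size c = n ->
      teval (nth 0 (rcons c y)) (ttrunc n r) = teval (nth 0 c) r.
    move=> sc; rewrite teval_trunc; apply: eq_teval => i; congr nth.
    apply: (@eq_from_nth _ 0) => [|j]; rewrite size_mkseq ?sc // => ltj.
    by rewrite nth_mkseq // nth_rcons sc ltj.
  exists (ttrunc n r); split; first by rewrite bS cS ?size_mkseq.
  move=> c a sc Hc; rewrite cS // => t; rewrite size_rcons sc bS => tb.
  set x := fun i => if (i < n)%N then TVar i else if i == n then r else TZero.
  have xE (P : naAlgType F) (d : seq P) : size d = n ->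
      teval (nth 0 (rcons d (teval (nth 0 d) r))) t = teval (nth 0 d) (tsubst x t).
    move=> sd; rewrite teval_subst; apply: eq_teval => i.
    by rewrite nth_rcons sd /x; case: ifP => //; case: ifP.
  by rewrite xE //; apply: Hc; rewrite sc -xE ?size_mkseq // rb.
exists (TVar n); split; first by rewrite /= nth_mkseq.
move=> c a sc Hc /= t; rewrite nth_rcons sc ltnn eqxx size_rcons sc bS.
have [k kE] := teval_rcons_mul0 t n.
rewrite (kE A) // (kE B) ?size_mkseq //; last exact: var_mul0.
have [-> |k0] := eqVneq k 0.
  by rewrite !scale0r !addr0 => tb; apply: Hc; rewrite sc.
(* A relation with k nonzero could be solved for b_n, against [nor]. *)
move=> /eqP; rewrite addr_eq0 => /eqP tb.
case: nor; exists (TScale (- k^-1) t) => /=.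
by rewrite tb scalerN scaleNr opprK scalerA mulVf // scale1r.
Qed.

End ZeroMultiplication.

HB.instance Definition _ (F : Type) := gen_eqMixin (term F).

(** * Nonzero multiplication: search for a root *)

Section NonzeroMultiplication.
Variables (F : fieldType) (A B : naAlgType F) (q : term F).
Hypotheses (A_minimal : minimal_algebra A) (A_finite : finite_set [set: A]).
Hypothesis qE : forall x y : A, teval2 q x y = if x == 0 then 0 else y.
Hypothesis B_var : in_var A B.

Lemma teval_ite (x : nat -> A) t u w :
  teval x (TIte q t u w) = if teval x t == 0 then teval x u else teval x w.
Proof.
rewrite tevalE_ite !qE.
by case: ifP; rewrite ?subr0 ?addr0 ?subrr ?add0r.
Qed.

(** This case of [qE] is an identity of A. The other one is conditional and need not pass to B, so
    there [TIte] is controlled only where its condition vanishes. *)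
Lemma support_term_var0 (y : B) : teval2 q 0 y = 0.
Proof.
suff: teval (fun=> y) (TApp2 q TZero (TVar 0)) = 0 by rewrite teval_app2.
by apply: (identity_transfer B_var) => x; rewrite teval_app2 qE eqxx.
Qed.

Lemma teval_ite_var0 (x : nat -> B) t u w :
  teval x t = 0 -> teval x (TIte q t u w) = teval x u.
Proof.
by move=> t0; rewrite tevalE_ite t0 !support_term_var0 subr0 addr0.
Qed.

Lemma finite_unary_terms : exists S : seq (term F),
  forall a y : A, a <> 0 -> exists2 s, s \in S & teval (fun=> a) s = y.
Proof.
have [eA eAE] := (finite_seqP [set: A]).1 A_finite.
have eAP x : x \in eA by have : [set: A] x by []; rewrite eAE.
suff [S SP] : exists S : seq (term F), forall p : A * A,
    p \in [seq (a, y) | a <- eA, y <- eA] -> p.1 <> 0 ->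
    exists2 s, s \in S & teval (fun=> p.1) s = p.2.
  by exists S => a y a0; apply: (SP (a, y)); rewrite ?allpairs_f.
elim: [seq _ | _ <- _, _ <- _] => [|[a y] L [S SP]]; first by exists [::].
have [a0|a0] := pselect (a = 0).
  exists S => p; rewrite inE => /orP[/eqP->|] //; exact: SP.
have [s sy] := generated_by_nonzero A_minimal y a0.
exists (s :: S) => p; rewrite inE => /orP[/eqP-> _|pL p0].
  by exists s; rewrite ?mem_head.
by have [t tS tp] := SP p pL p0; exists t; rewrite // inE tS orbT.
Qed.

Lemma finite_seqs (N : nat) : exists L : seq (seq A),
  forall c : seq A, size c = N -> c \in L.
Proof.
have [eA eAE] := (finite_seqP [set: A]).1 A_finite.
have eAP x : x \in eA by have : [set: A] x by []; rewrite eAE.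
elim: N => [|N [L LP]]; first by exists [:: [::]] => -[].
exists [seq a :: c | a <- eA, c <- L] => -[|a c] //= [sc].
by rewrite allpairs_f ?LP.
Qed.

Variable b : nat -> B.

(** Incompatible zeros are removed one at a time, each by a relation of [b] failing there. *)
Lemma compatible_zero_set (N : nat) : exists2 v : term F,
    teval (nth 0 (mkseq b N)) v = 0
  & forall c : seq A, size c = N -> teval (nth 0 c) v = 0 -> compatible b c.
Proof.
have [L LP] := finite_seqs N.
suff [v vb vL] : exists2 v : term F, teval (nth 0 (mkseq b N)) v = 0
    & forall c : seq A, c \in L -> size c = N -> teval (nth 0 c) v = 0 ->
      compatible b c.
  by exists v => // c sc; apply: vL; rewrite ?LP.
elim: L {LP} => [|d L [v vb vL]]; first by exists TZero.
have [vd|/not_implyP[sd /not_implyP[vd /existsNP[w /not_implyP[wb wd]]]]] :=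
  pselect (size d = N -> teval (nth 0 d) v = 0 -> compatible b d).
  exists v => // c; rewrite inE => /orP[/eqP->|] //; exact: vL.
(* The zeros of this term in A are the common zeros of v and w. *)
rewrite sd in wb; exists (TIte q v w v); first by rewrite teval_ite_var0.
move=> c; rewrite inE teval_ite => /orP[/eqP-> _|cL sc].
  by rewrite vd eqxx => /wd.
by case: eqP => [vc _|vc /vc//]; exact: vL.
Qed.

Section Retraction.
Variables (n : nat) (v : term F) (S : seq (term F)).
Hypothesis vb : teval (nth 0 (mkseq b n.+1)) v = 0.
Hypothesis SP :
  forall a y : A, a <> 0 -> exists2 s, s \in S & teval (fun=> a) s = y.

Definition subst_last (e : term F) : term F :=
  tsubst (fun j => if (j < n)%N then TVar j else if j == n then e else TZero) v.

Lemma teval_subst_last (P : naAlgType F) (x : nat -> P) e :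
  teval x (subst_last e) = teval (nth 0 (rcons (mkseq x n) (teval x e))) v.
Proof.
rewrite teval_subst; apply: eq_teval => j; rewrite nth_rcons size_mkseq.
by case: ltnP => [ltj|_]; [rewrite nth_mkseq | case: eqP].
Qed.

(** By [SP], the terms s(x_i) take every value in A once x_i is nonzero; [TZero] covers the case
    where all x_i vanish. *)
Definition candidates : seq (term F) :=
  TZero :: [seq tsubst (fun=> TVar i) s | i <- iota 0 n, s <- S].

(** Turns the existence of a root among the candidates into equations, which compatible sequences
    inherit from [b]. *)
Definition root_free (i : nat) : term F :=
  foldr (fun e acc => TApp2 q (subst_last e) acc) (TVar i) candidates.

Lemma teval_root_free (x : nat -> A) i :
  teval x (root_free i) =
  if has (fun e => teval (nth 0 (rcons (mkseq x n) (teval x e))) v == 0)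
    candidates then 0 else x i.
Proof.
rewrite /root_free; elim: candidates => //= e L IH.
by rewrite teval_app2 qE teval_subst_last IH; case: ifP.
Qed.

(* The identity u = q(v(x, y), u) of A, for u = root_free i: if v(x, y) = 0 and
   x_i is nonzero then y is the value of a candidate. *)
Lemma root_free_var0 i : (i < n)%N -> teval (nth 0 (mkseq b n)) (root_free i) = 0.
Proof.
move=> lt_in; set u := root_free i.
(* At [b], where v vanishes, the identity gives u = q(0, u) = 0. *)
suff: teval b (TSub (ttrunc n u) (TApp2 q (ttrunc n.+1 v) (ttrunc n u))) = 0.
  by rewrite teval_sub teval_app2 !teval_trunc vb support_term_var0 subr0.
apply: (identity_transfer B_var) => x.
rewrite teval_sub teval_app2 !teval_trunc qE; case: eqP => [vx|]; last by rewrite subrr.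
rewrite subr0 teval_root_free nth_mkseq //.
have -> : mkseq (nth 0 (mkseq x n)) n = mkseq x n.
  by rewrite -{2}(size_mkseq x n) mkseq_nth.
case: ifP => // /negbT/hasPn nocand; apply: contrapT => xi0.
have [s sS sx] := SP (x n) xi0.
have /nocand : tsubst (fun=> TVar i) s \in candidates.
  rewrite inE; apply/orP; right.
  by apply: (allpairs_f (fun i => tsubst (fun=> TVar i))); rewrite ?mem_iota.
by rewrite teval_subst /= nth_mkseq // sx -mkseq_rcons vx eqxx.
Qed.

(** Compatibility makes every [root_free i] with i < n vanish at [c]. If no candidate were a root,
    all entries of [c] would be zero, and then [TZero] is a root. *)
Lemma candidate_exists (c : seq A) : size c = n -> compatible b c ->
  has (fun e => teval (nth 0 (rcons c (teval (nth 0 c) e))) v == 0) candidates.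
Proof.
move=> sc Hc; apply/negPn/negP => nocand.
have cE : mkseq (nth 0 c) n = c by rewrite -{2}(mkseq_nth 0 c) sc.
have c0 i : nth 0 c i = 0.
  have [lt_in|] := ltnP i n; last by move=> ?; rewrite nth_default ?sc.
  have := Hc (root_free i); rewrite sc root_free_var0 // => /(_ erefl).
  by rewrite teval_root_free cE (negPf nocand).
case/hasP: nocand; exists TZero; first exact: mem_head.
rewrite teval0 // => i /=.
by rewrite nth_rcons; case: ifP => // _; case: ifP.
Qed.

(** [TVar n] is tried first: it already succeeds at [b], so in B only the zero branch of [TIte] is
    met. On compatible sequences the final [TZero] is never reached. *)
Definition first_root : term F :=
  foldr (fun e acc => TIte q (subst_last e) e acc) TZero
    (TVar n :: map (ttrunc n) candidates).

Lemma teval_first_root (c : seq A) (a : A) : size c = n -> compatible b c ->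
  teval (nth 0 (rcons c (teval (nth 0 (rcons c a)) first_root))) v = 0.
Proof.
move=> sc Hc.
have cE : mkseq (nth 0 (rcons c a)) n = c.
  apply: (@eq_from_nth _ 0) => [|j]; rewrite size_mkseq ?sc // => ltj.
  by rewrite nth_mkseq // nth_rcons sc ltj.
have : has (fun e => teval (nth 0 (rcons c (teval (nth 0 (rcons c a)) e))) v == 0)
    (TVar n :: map (ttrunc n) candidates).
  rewrite [has _ _]/= has_map; apply/orP; right.
  apply: sub_has (candidate_exists sc Hc) => e.
  by rewrite /= teval_trunc cE.
rewrite /first_root; elim: (_ :: _) => [//|e L IH].
rewrite [foldr _ _ _]/= [has _ _]/= teval_ite teval_subst_last cE.
by case: eqP => //= _ /IH.
Qed.

Lemma first_root_var : teval (nth 0 (mkseq b n.+1)) first_root = b n.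
Proof.
rewrite /first_root [foldr _ _ _]/= teval_ite_var0 /= ?nth_mkseq //.
rewrite teval_subst_last /= nth_mkseq // -[RHS]vb mkseq_rcons.
congr (teval (nth 0 (rcons _ (b n))) v).
apply: (@eq_from_nth _ 0) => [|j]; rewrite !size_mkseq // => ltj.
by rewrite !nth_mkseq // nth_rcons size_mkseq ltj nth_mkseq.
Qed.

End Retraction.

Lemma has_retraction_mul n : has_retraction A b n.
Proof.
have [S SP] := finite_unary_terms.
have [v vb vP] := compatible_zero_set n.+1.
exists (first_root n v S); split; first exact: first_root_var.
move=> c a sc Hc; apply: vP; first by rewrite size_rcons sc.
exact: teval_first_root.
Qed.

End NonzeroMultiplication.

Lemma minimal_has_retraction (F : fieldType) (A B : naAlgType F) (b : nat -> B) n :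
  finite_set [set: A] -> minimal_algebra A -> in_var A B -> has_retraction A b n.
Proof.
move=> A_finite A_minimal B_var.
have [A_mul|A_mul0] := pselect (exists u w : A, u ** w <> 0).
  have [q qE] := support_term A_minimal A_finite A_mul.
  exact: (has_retraction_mul A_minimal A_finite qE).
apply: has_retraction_mul0 => // u w.
by apply: contrapT => uw; apply: A_mul0; exists u, w.
Qed.

(** * Recursive construction of the terms t_n *)

Section Lifting.
Variables (F : fieldType) (A B Fr : naAlgType F) (b : nat -> B).
Hypothesis Fr_var : in_var A Fr.
Variable r : nat -> term F.
Hypothesis rb : forall n, teval (nth 0 (mkseq b n.+1)) (r n) = b n.
Hypothesis rP : forall n (c : seq A) (a : A), size c = n -> compatible b c ->
  compatible b (rcons c (teval (nth 0 (rcons c a)) (r n))).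

(** The whole list is built at once, since t_m depends on all earlier terms; [TVar m] is the entry
    to be corrected. *)
Fixpoint lifts (n : nat) : seq (term F) :=
  if n is m.+1 then
    rcons (lifts m) (tsubst (nth TZero (rcons (lifts m) (TVar m))) (r m))
  else [::].

Definition lift (n : nat) : term F := nth TZero (lifts n.+1) n.

Lemma liftsE n : lifts n = mkseq lift n.
Proof.
elim: n => // n IH; rewrite mkseq_rcons -IH /lift /= IH.
by rewrite nth_rcons size_mkseq ltnn eqxx.
Qed.

Lemma teval_lifts (P : naAlgType F) (x : nat -> P) n :
  map (teval x) (lifts n.+1) = rcons (map (teval x) (lifts n))
    (teval (nth 0 (rcons (map (teval x) (lifts n)) (x n))) (r n)).
Proof.
rewrite /= map_rcons teval_subst; congr rcons; apply: eq_teval => i.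
rewrite !nth_rcons size_map; case: ltnP => lti; first by rewrite (nth_map TZero).
by case: eqP.
Qed.

Lemma teval_lift n : teval b (lift n) = b n.
Proof.
have lE m : map (teval b) (lifts m) = mkseq b m.
  elim: m => // m IH; rewrite teval_lifts IH mkseq_rcons; congr rcons.
  by rewrite -mkseq_rcons rb.
have := congr1 (nth 0 ^~ n) (lE n.+1).
by rewrite /= -/(lifts n.+1) (nth_map TZero) ?nth_mkseq // liftsE size_mkseq.
Qed.

Lemma compatible_lifts (x : nat -> A) n : compatible b (map (teval x) (lifts n)).
Proof.
elim: n => [|n IH]; last by rewrite teval_lifts; apply: rP; rewrite // liftsE size_map size_mkseq.
by move=> t _; apply: teval0 => i; rewrite nth_nil.
Qed.

(** By compatibility, substituting the lifts into a relation of [b] gives an identity of A, which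
    passes to Fr. *)
Lemma teval_lift_relation (x : nat -> Fr) (t : term F) :
  teval b t = 0 -> teval (fun i => teval x (lift i)) t = 0.
Proof.
have [n nt] := teval_finite_support t.
rewrite nt teval_trunc => tb; rewrite -teval_subst.
apply: (identity_transfer Fr_var) => y; rewrite teval_subst nt teval_trunc.
have := @compatible_lifts y n t; rewrite liftsE size_map size_mkseq => /(_ tb).
by rewrite /mkseq -map_comp.
Qed.

End Lifting.

(** * Embedding in the free algebra *)

Theorem theorem19 (F : fieldType) (A : naAlgType F)
    (A_finite : finite_set [set: A]) (A_minimal : minimal_algebra A)
    (Fr : naAlgType F) (X : set Fr)
    (Fr_free : free_countable_rank (in_var A) X)
    (B : naAlgType F) (B_var : in_var A B) (B_countable : countable [set: B]) :
  embeds B Fr.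
Proof.
have [Fr_var [_ X_infinite] _ X_free] := Fr_free.
have [idx idx_inj] := countable_injP _ B_countable.
(* Indices outside the range of [idx] get b_n = 0. *)
have /choice[b bK] n : exists y, forall z, idx z = n -> y = z.
  have [[y yn]|nopre] := pselect (exists y, idx y = n).
    by exists y => z zn; apply: idx_inj; rewrite ?inE // yn.
  by exists 0 => z zn; case: nopre; exists z.
have [r rP] := choice (fun n => minimal_has_retraction b n A_finite A_minimal B_var).
have rb n : teval (nth 0 (mkseq b n.+1)) (r n) = b n by case: (rP n).
have rc n : forall (c : seq A) (a : A), size c = n -> compatible b c ->
    compatible b (rcons c (teval (nth 0 (rcons c a)) (r n))).
  by case: (rP n).
(* The left inverse [h] makes the generators x_n distinct; it is defined on all of Fr, as [X_free]
   expects. *)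
have [x [h xX hx]] : exists x : nat -> Fr, exists2 h : Fr -> nat,
    forall n, X (x n) & forall n, h (x n) = n.
  case/infiniteP/pfcard_geP: X_infinite => [/seteqP[/(_ 0%N)]|[h]]; first by case.
  have /choice[x xP] n : exists y, X y /\ h y = n.
    by have [y Xy hy] := @surj _ _ _ _ h n I; exists y.
  by exists x; exists h => n; have [] := xP n.
have [f fM fX] := X_free B B_var (b \o h).
have fx n : f (x n) = b n by rewrite fX ?inE //= hx.
pose s (y : B) : Fr := teval x (lift r (idx y)).
have b_idx y : b (idx y) = y by exact: bK.
have sE (t : term F) : teval b t = 0 -> teval (fun i => teval x (lift r i)) t = 0.
  exact: (teval_lift_relation Fr_var rc).
(* Linearity at these arguments is a relation between entries of [b], which [sE] carries to the
   lifts. *)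
have s_linear a y z : s (a *: y + z) = a *: s y + s z.
  have := sE (TSub (TVar (idx (a *: y + z)))
    (TAdd (TScale a (TVar (idx y))) (TVar (idx z)))).
  by rewrite !teval_sub /= !b_idx subrr => /(_ erefl)/eqP; rewrite subr_eq0 => /eqP.
have fs : cancel s f.
  move=> y; rewrite /s teval_hom // (eq_teval (y := b)) //.
  by rewrite teval_lift.
have s_mul y z : s (y ** z) = s y ** s z.
  have := sE (TSub (TVar (idx (y ** z))) (TMul (TVar (idx y)) (TVar (idx z)))).
  by rewrite !teval_sub /= !b_idx subrr => /(_ erefl)/eqP; rewrite subr_eq0 => /eqP.
pose s' : {linear B -> Fr} := HB.pack s (GRing.isLinear.Build F B Fr *:%R s s_linear).
by exists s' => //; exact: can_inj fs.
Qed.
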